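(* Let $0<R\le\infty$ and let $(\mathcal{R}_1,\mu_1)$ and $(\mathcal{R}_2,\mu_2)$ be non-atomic $\sigma$-finite measure spaces with $\mu_1(\mathcal{R}_1)=\mu_2(\mathcal{R}_2)=R$. Let $\varphi,\psi$ be quasiconcave functions on $[0,R)$, both satisfying the $B$-condition. Suppose that $T$ is a quasilinear operator such that $$T\colon M_\varphi(\mathcal{R}_1)\to M_\varphi(\mathcal{R}_2)\quad\text{and}\quad T\colon M_\psi(\mathcal{R}_1)\to M_\psi(\mathcal{R}_2)$$ are bounded. Let $X_i(\mathcal{R}_i)$, $i=1,2$, be rearrangement-invariant Banach function spaces satisfying $$M_\varphi(\mathcal{R}_i)\cap M_\psi(\mathcal{R}_i)\subset X_i(\mathcal{R}_i)\subset M_\varphi(\mathcal{R}_i)+M_\psi(\mathcal{R}_i),\quad i=1,2.$$ If $$S_\varphi\colon X_1(0,R)\to X_2(0,R)\quad\text{and}\quad T_\psi\colon X_1(0,R)\to X_2(0,R)$$ are bounded, then $T\colon X_1(\mathcal{R}_1)\to X_2(\mathcal{R}_2)$ is bounded.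
   Context: For a measure space $(\mathcal{R},\mu)$, $\mathcal{M}(\mathcal{R},\mu)$ denotes the $\mu$-measurable a.e. finite extended real-valued functions. The non-increasing rearrangement is $f^*(t)=\inf\{\lambda>0: \mu(\{x:|f(x)|>\lambda\})\le t\}$, $t\in[0,R)$, and $f^{**}(t)=\frac1t\int_0^t f^*(s)\,ds$. A function $\varphi\colon[0,R)\to[0,\infty)$ is quasiconcave if $\varphi(t)=0$ iff $t=0$, $\varphi$ is non-decreasing, and $\varphi(t)/t$ is non-increasing on $(0,R)$. It satisfies the $B$-condition ($\varphi\in B$) if there is $C>0$ with $\frac1t\int_0^t \frac{ds}{\varphi(s)}\le \frac{C}{\varphi(t)}$ for all $t\in(0,R)$. The Marcinkiewicz space $M_\varphi(\mathcal{R},\mu)$ consists of $f\in\mathcal{M}(\mathcal{R},\mu)$ with $\|f\|_{M_\varphi}=\sup_{0<s<R}\varphi(s)f^{**}(s)<\infty$. For $f$ measurable and $t\in(0,R)$: $S_\varphi f(t)=\frac{1}{\varphi(t)}\sup_{0<s<t}\varphi(s)f^*(s)$ and $T_\psi f(t)=\frac{1}{\psi(t)}\sup_{t<s<R}\psi(s)f^*(s)$. A rearrangement-invariant (r.i.) Banach function space $X(\mathcal{R},\mu)$ is given by an r.i. Banach function norm on $(0,R)$ (space $X(0,R)$ on $[0,R)$ with Lebesgue measure) via $\|f\|_{X(\mathcal{R},\mu)}=\|f^*\|_{X(0,R)}$; $X_i(0,R)$ denotes this representation space of $X_i(\mathcal{R}_i)$. An operator $T$ is quasilinear if $|T(\lambda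 f)|=|\lambda||Tf|$ and $|T(f+g)|\le C(|Tf|+|Tg|)$ a.e. for some constant $C$. ''$T\colon X\to Y$'' means $T$ maps $X$ boundedly into $Y$. *)

(* Defs.v *)
From HB Require Import structures.
From mathcomp Require Import all_boot all_order all_algebra.
From mathcomp Require Import all_classical all_reals all_analysis.
From mathcomp Require Import measurable_realfun.
Set Implicit Arguments. Unset Strict Implicit. Unset Printing Implicit Defensive.
Import Order.TTheory GRing.Theory Num.Theory.
Local Open Scope classical_set_scope.
Local Open Scope ring_scope.
Local Open Scope ereal_scope.

Section Defs.
Variable R : realType.

Definition Iv (Rtot : \bar R) : set R := [set t : R | (0 < t)%R /\ t%:E < Rtot].

Notation leb := (@lebesgue_measure R).

Definition nonatomic d (T : measurableType d) (mu : set T -> \bar R) :=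
  forall A : set T, measurable A -> 0 < mu A ->
    exists B : set T, [/\ measurable B, B `<=` A, 0 < mu B & mu B < mu A].

Definition dstar d (T : measurableType d) (mu : set T -> \bar R) (D : set T)
  (f : T -> R) : R -> \bar R :=
  fun t => ereal_inf [set l%:E | l in
     [set l : R | (0 < l)%R /\ mu (D `&` [set x | (l < `|f x|)%R]) <= t%:E]].

Definition dstar2 d (T : measurableType d) (mu : set T -> \bar R) (D : set T)
  (f : T -> R) : R -> \bar R :=
  fun t => (t^-1)%:E * \int[leb]_(s in `]0%R, t]) dstar mu D f s.

Definition quasiconcave (Rtot : \bar R) (phi : R -> R) :=
  [/\ (forall t, (0 <= t)%R -> t%:E < Rtot -> (0 <= phi t)%R),
      (forall t, (0 <= t)%R -> t%:E < Rtot -> (phi t = 0 <-> t = 0)%R),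
      (forall s t, (0 <= s)%R -> (s <= t)%R -> t%:E < Rtot -> (phi s <= phi t)%R) &
      (forall s t, (0 < s)%R -> (s <= t)%R -> t%:E < Rtot ->
         (phi t / t <= phi s / s)%R)].

Definition Bcond (Rtot : \bar R) (phi : R -> R) :=
  exists C : R, (0 < C)%R /\ forall t, Iv Rtot t ->
    (t^-1)%:E * \int[leb]_(s in `]0%R, t]) ((phi s)^-1)%:E <= (C / phi t)%:E.

Definition Mnorm (Rtot : \bar R) (phi : R -> R) d (T : measurableType d)
  (mu : set T -> \bar R) (f : T -> R) : \bar R :=
  ereal_sup [set (phi s)%:E * dstar2 mu setT f s | s in Iv Rtot].

Definition inM (Rtot : \bar R) (phi : R -> R) d (T : measurableType d)
  (mu : set T -> \bar R) (f : T -> R) :=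
  measurable_fun setT f /\ Mnorm Rtot phi mu f < +oo.

Definition inMsum (Rtot : \bar R) (phi psi : R -> R) d (T : measurableType d)
  (mu : set T -> \bar R) (f : T -> R) :=
  exists g h : T -> R, [/\ inM Rtot phi mu g, inM Rtot psi mu h & f = (g \+ h)%R].

(* rearrangement-invariant Banach function norm on (0, Rtot) with Lebesgue
   measure, acting on non-negative measurable functions (Bennett-Sharpley) *)
Definition nnm (Rtot : \bar R) (f : R -> \bar R) :=
  (forall t, Iv Rtot t -> 0 <= f t) /\ measurable_fun (Iv Rtot) f.

Section BFN.
Variables (Rtot : \bar R) (rho : (R -> \bar R) -> \bar R).

Definition bfn_nonneg := forall f, nnm Rtot f -> 0 <= rho f.

Definition bfn_P1 :=
  [/\ (forall f, nnm Rtot f ->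
         (rho f = 0 <-> {ae leb, forall t, Iv Rtot t -> f t = 0})),
      (forall f (a : R), nnm Rtot f -> (0 <= a)%R ->
         rho (fun t => a%:E * f t) = a%:E * rho f) &
      (forall f g, nnm Rtot f -> nnm Rtot g -> rho (f \+ g) <= rho f + rho g)].

Definition bfn_P2 :=
  forall f g, nnm Rtot f -> nnm Rtot g ->
    {ae leb, forall t, Iv Rtot t -> g t <= f t} -> rho g <= rho f.

Definition bfn_P3 :=
  forall (fs : nat -> R -> \bar R) f, (forall n, nnm Rtot (fs n)) -> nnm Rtot f ->
    {ae leb, forall t, Iv Rtot t ->
       {homo (fun n => fs n t) : m n / (m <= n)%N >-> m <= n} /\
       fs n t @[n --> \oo] --> f t} ->
    rho (fs n) @[n --> \oo] --> rho f.

Definition bfn_P4 :=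
  forall E : set R, measurable E -> E `<=` Iv Rtot -> leb E < +oo ->
    rho (fun t => (\1_E t)%:E) < +oo.

Definition bfn_P5 :=
  forall E : set R, measurable E -> E `<=` Iv Rtot -> leb E < +oo ->
    exists C : R, (0 <= C)%R /\ forall f, nnm Rtot f ->
      \int[leb]_(t in E) f t <= C%:E * rho f.

Definition bfn_ri :=
  forall f g, nnm Rtot f -> nnm Rtot g ->
    (forall l : R, (0 <= l)%R ->
       leb (Iv Rtot `&` [set t | l%:E < f t]) =
       leb (Iv Rtot `&` [set t | l%:E < g t])) ->
    rho f = rho g.

Definition ri_bfn :=
  [/\ bfn_nonneg, bfn_P1, bfn_P2, bfn_P3 & [/\ bfn_P4, bfn_P5 & bfn_ri]].

End BFN.

Definition Xnorm (rho : (R -> \bar R) -> \bar R) d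
  (T : measurableType d) (mu : set T -> \bar R) (f : T -> R) : \bar R :=
  rho (dstar mu setT f).

Definition inX (rho : (R -> \bar R) -> \bar R) d
  (T : measurableType d) (mu : set T -> \bar R) (f : T -> R) :=
  measurable_fun setT f /\ Xnorm rho mu f < +oo.

Definition Xnorm0 (rho : (R -> \bar R) -> \bar R) (f : R -> R) : \bar R :=
  rho (fun t => (`|f t|)%:E).

Definition inX0 (Rtot : \bar R) (rho : (R -> \bar R) -> \bar R) (f : R -> R) :=
  measurable_fun (Iv Rtot) f /\ Xnorm0 rho f < +oo.

Definition Sop (Rtot : \bar R) (phi : R -> R) (f : R -> R) : R -> \bar R :=
  fun t => ((phi t)^-1)%:E *
    ereal_sup [set (phi s)%:E * dstar leb (Iv Rtot) f s | s in
               [set s : R | (0 < s)%R /\ (s < t)%R]].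

Definition Top (Rtot : \bar R) (psi : R -> R) (f : R -> R) : R -> \bar R :=
  fun t => ((psi t)^-1)%:E *
    ereal_sup [set (psi s)%:E * dstar leb (Iv Rtot) f s | s in
               [set s : R | (t < s)%R /\ s%:E < Rtot]].

Definition bounded0 (Rtot : \bar R) (rho1 rho2 : (R -> \bar R) -> \bar R)
  (S : (R -> R) -> R -> \bar R) :=
  exists C : R, (0 <= C)%R /\ forall f, inX0 Rtot rho1 f ->
    rho2 (S f) <= C%:E * Xnorm0 rho1 f.

Definition quasilinear_on d1 (T1 : measurableType d1) d2 (T2 : measurableType d2)
  (dom : (T1 -> R) -> Prop) (mu2 : {measure set T2 -> \bar R})
  (Op : (T1 -> R) -> (T2 -> R)) :=
  [/\ (forall f, dom f -> measurable_fun setT (Op f)),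
      (forall f (l : R), dom f ->
         {ae mu2, forall x, `|Op (fun y => l * f y)%R x| = `|l| * `|Op f x|}%R) &
      exists C : R, (0 < C)%R /\ forall f g, dom f -> dom g ->
         {ae mu2, forall x, `|Op (f \+ g) x| <= C * (`|Op f x| + `|Op g x|)}%R].

End Defs.

(* Main.v *)
(* For t in (0, Rtot) cut f at the height l = f^*(t): f = g + h with
   g = f 1_{|f| > l} and h = f 1_{|f| <= l}.  Then g^* vanishes on [t, Rtot) and
   is at most f^* before, so that g^* <= phi(t) S_phi f(t) / phi, while
   h^* <= min(f^*, l) is at most psi(t) (T_psi f(t) + 2 S_phi f(t)) / psi, since
   l <= f^*(t/2) <= 2 S_phi f(t).  By the B-condition these are bounds of the
   norms of g in M_phi and of h in M_psi, so the endpoint estimates bound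
   (Op g)^*(t/2) and (Op h)^*(t/2); as phi(t) <= 2 phi(t/2) and
   psi(t) <= 2 psi(t/2), quasilinearity yields the pointwise inequality
   (Op f)^*(t) <= K (S_phi f(t) + T_psi f(t)) without any dilation of the
   argument.  It remains to apply the norm of X_2. *)

Require Import Defs.
From HB Require Import structures.
From mathcomp Require Import all_boot all_order all_algebra.
From mathcomp Require Import all_classical all_reals all_analysis.
From mathcomp Require Import measurable_realfun.
From mathcomp Require Import ring lra.
Import Order.TTheory GRing.Theory Num.Theory.
Local Open Scope classical_set_scope.
Local Open Scope ring_scope.
Local Open Scope ereal_scope.

(** * Measurability of monotone extended-real functions *)

Lemma nonincreasing_emeasurable (R : realType) (D : set R) (f : R -> \bar R) :
  (forall x y, D x -> D y -> (x <= y)%R -> f y <= f x) -> measurable_fun D f.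
Proof.
move=> f_dec mD.
apply: (measurability _ (ErealGenOInfty.measurableE R)) => //.
move=> _ [_ [r ->] <-].
(* [U] is the downward closure of the superlevel set of [f] in [D]. Being an interval it is
   measurable, and monotonicity of [f] makes it agree with the superlevel set on [D]. *)
pose U := [set x | exists2 y, D y & (x <= y)%R /\ r%:E < f y].
have -> : D `&` f @^-1` `]r%:E, +oo[ = D `&` U.
  apply/seteqP; split => x /= [Dx].
    by rewrite in_itv/= andbT => rfx; split => //; exists x.
  move=> [y Dy [xy ry]]; split => //.
  by rewrite in_itv/= andbT (lt_le_trans ry)// f_dec.
apply: measurableI => //; apply: is_interval_measurable.
move=> a b _ [y Dy [by_ ry]] c /andP[_ cb].
by exists y => //; split => //; exact: le_trans by_.
Qed.

Lemma nondecreasing_emeasurable (R : realType) (D : set R) (f : R -> \bar R) :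
  (forall x y, D x -> D y -> (x <= y)%R -> f x <= f y) -> measurable_fun D f.
Proof.
move=> f_inc; have -> : f = \- (\- f) by apply/funext => x; rewrite oppeK.
apply: measurableT_comp; first exact: oppe_measurable.
by apply: nonincreasing_emeasurable => x y Dx Dy xy; rewrite leeN2 f_inc.
Qed.

(** * Level sets and the non-increasing rearrangement *)

Section Rearrangement.
Set Implicit Arguments. Unset Strict Implicit.
Context (R : realType) (d : measure_display) (T : measurableType d).
Implicit Types (mu : {measure set T -> \bar R}) (D : set T) (f g h : T -> R).

Lemma dstar_ge0 mu D f t : 0 <= dstar mu D f t.
Proof.
by apply: le_ereal_inf_tmp => _ [l [l0 _] <-]; rewrite lee_fin ltW.
Qed.

Lemma dstar_nonincreasing mu D f s t : (s <= t)%R ->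
  dstar mu D f t <= dstar mu D f s.
Proof.
move=> st; apply: ereal_inf_le_tmp => _ [l [l0 sl] <-].
by exists l => //; split => //; rewrite (le_trans sl)// lee_fin.
Qed.

Lemma measurable_dstar mu D f E : measurable_fun E (dstar mu D f).
Proof.
by apply: nonincreasing_emeasurable => x y _ _; exact: dstar_nonincreasing.
Qed.

Lemma measurable_gt_norm D f l : measurable D -> measurable_fun D f ->
  measurable (D `&` [set x | (l < `|f x|)%R]).
Proof.
move=> mD mf.
have := @emeasurable_fun_o_infty _ _ R D (fun x => (`|f x|)%:E) mD.
move=> /(_ _ l%:E); under eq_set do rewrite lte_fin; apply.
by apply/measurable_EFinP; apply: measurableT_comp mf.
Qed.

Lemma le_mu mu A B : measurable A -> measurable B -> A `<=` B -> mu A <= mu B.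
Proof. by move=> mA mB; apply: le_measure; rewrite inE. Qed.

(** The infimum defining f^* runs over strictly positive levels, so [l = 0] is reached only as a
    limit: every [l + e] with [e > 0] is an admissible level. *)
Lemma dstar_le mu D f t l : measurable D -> measurable_fun D f -> (0 <= l)%R ->
  mu (D `&` [set x | (l < `|f x|)%R]) <= t%:E -> dstar mu D f t <= l%:E.
Proof.
move=> mD mf l0 lt; apply/lee_addgt0Pr => e e0.
apply: ereal_inf_lbound; exists (l + e)%R; last by rewrite EFinD.
split; first exact: ltr_wpDl.
apply: le_trans lt; apply: le_mu; [exact: measurable_gt_norm..|].
by apply: setIS => x /=; apply: lt_trans; rewrite ltrDl.
Qed.

(** Converse of [dstar_le], by right-continuity of the distribution function: {|f| > l} is the
    increasing union of the sets {|f| > l + 1/(n+1)}, and measures are continuous from below. *)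
Lemma mu_gt_dstar mu D f t l : measurable D -> measurable_fun D f -> (0 <= l)%R ->
  dstar mu D f t <= l%:E -> mu (D `&` [set x | (l < `|f x|)%R]) <= t%:E.
Proof.
move=> mD mf l0 fl.
pose A n := D `&` [set x | (l + n.+1%:R^-1 < `|f x|)%R].
have mA n : measurable (A n) by exact: measurable_gt_norm.
have UA : D `&` [set x | (l < `|f x|)%R] = \bigcup_n A n.
  apply/seteqP; split => x /=.
    move=> [Dx lfx]; have [n ln] := ltr_add_invr lfx.
    by exists n => //; split.
  by move=> [n _ [Dx /= ln]]; split => //; apply: lt_trans ln; rewrite ltrDl.
have A_inc : {homo A : n m / (n <= m)%N >-> (n <= m)%O}.
  move=> n m nm; apply/subsetPset; apply: setIS => x /=.
  by apply: le_lt_trans; rewrite lerD2l lef_pV2 ?posrE// ler_nat.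
have mUA : measurable (\bigcup_n A n) by exact: bigcupT_measurable.
have cvA := nondecreasing_cvg_mu (mu := mu) mA mUA A_inc.
rewrite UA -(cvg_lim _ cvA)//; apply: lime_le; first by apply/cvg_ex; eexists; exact: cvA.
apply: nearW => n /=.
(* The strict gap above the infimum yields an admissible level [k] below l + 1/(n+1), whose level
   set contains [A n]. *)
have : dstar mu D f t < (l + n.+1%:R^-1)%:E.
  by apply: le_lt_trans fl _; rewrite lte_fin ltrDl.
move=> /ereal_inf_lt[_ [k [k0 kt] <-]]; rewrite lte_fin => kl.
apply: le_trans kt; apply: le_mu => //; first exact: measurable_gt_norm.
by apply: setIS => x /=; apply: lt_trans.
Qed.

Lemma dstar_le_abs mu f g t : measurable_fun setT f -> measurable_fun setT g ->
  (forall x, `|f x| <= `|g x|)%R -> dstar mu setT f t <= dstar mu setT g t.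
Proof.
move=> mf mg fg; apply: ereal_inf_le_tmp => _ [l [l0 sl] <-].
exists l => //; split => //; apply: le_trans sl.
apply: le_mu; [exact: measurable_gt_norm..|].
by apply: setIS => x /= /lt_le_trans; apply.
Qed.

(** With a = g^*(t/2) and b = h^*(t/2), almost everywhere |f| > C(a + b) forces |g| > a or |h| > b,
    and each of these two events has measure at most t/2. *)
Lemma dstar_quasi_subadditive mu f g h (C t : R) : (0 < C)%R ->
  measurable_fun setT f -> measurable_fun setT g -> measurable_fun setT h ->
  {ae mu, forall x, `|f x| <= C * (`|g x| + `|h x|)}%R ->
  dstar mu setT f t <=
    C%:E * (dstar mu setT g (t / 2) + dstar mu setT h (t / 2)).
Proof.
move=> C0 mf mg mh [N [mN N0 fgh]].
have g0 := dstar_ge0 mu setT g (t / 2); have h0 := dstar_ge0 mu setT h (t / 2).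
(* An infinite value of g^* or h^* makes the right-hand side [+oo], because [C] is positive. *)
case Eg : (dstar mu setT g (t / 2)) g0 => [a| |] // g0; last first.
  by rewrite addye ?gt0_muley ?leey// gt_eqF// (lt_le_trans _ h0).
case Eh : (dstar mu setT h (t / 2)) h0 => [b| |] // h0; last first.
  by rewrite addey ?gt0_muley ?leey.
rewrite !lee_fin in g0 h0; rewrite -EFinD -EFinM.
have ga : mu (setT `&` [set x | (a < `|g x|)%R]) <= (t / 2)%:E.
  by apply: mu_gt_dstar; rewrite ?Eg.
have hb : mu (setT `&` [set x | (b < `|h x|)%R]) <= (t / 2)%:E.
  by apply: mu_gt_dstar; rewrite ?Eh.
apply: dstar_le => //; first by rewrite mulr_ge0 ?addr_ge0// ltW.
set G := _ `&` _ in ga; set H := _ `&` _ in hb.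
have mG : measurable G by exact: measurable_gt_norm.
have mH : measurable H by exact: measurable_gt_norm.
apply: (@le_trans _ _ (mu (N `|` (G `|` H)))).
  apply: le_mu; [exact: measurable_gt_norm|exact/measurableU/measurableU|].
  move=> x [_ /= fx]; apply: contrapT => /not_orP[Nx /not_orP[Gx Hx]].
  apply/Nx/fgh => /= fle; move: fx; apply/negP; rewrite -leNgt.
  apply: le_trans fle _; rewrite ler_pM2l// lerD//.
    by rewrite leNgt; apply/negP => ?; apply: Gx.
  by rewrite leNgt; apply/negP => ?; apply: Hx.
apply: (@le_trans _ _ (mu N + mu (G `|` H))).
  exact/(measureU2 _ mN)/measurableU.
rewrite N0 add0e (_ : t = t / 2 + t / 2)%R; last by lra.
apply: (@le_trans _ _ (mu G + mu H)); first exact: measureU2.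
by rewrite EFinD leeD.
Qed.

End Rearrangement.

(** * Quasiconcave functions, Marcinkiewicz norms and the endpoint estimate *)

Section Marcinkiewicz.
Set Implicit Arguments. Unset Strict Implicit.
Context (R : realType) (Rtot : \bar R).
Implicit Types (phi psi : R -> R).

Lemma Iv_le s t : Iv Rtot t -> (0 < s)%R -> (s <= t)%R -> Iv Rtot s.
Proof. by move=> [_ tR] s0 st; split => //; rewrite (le_lt_trans _ tR) ?lee_fin. Qed.

Lemma Iv_half t : Iv Rtot t -> Iv Rtot (t / 2)%R.
Proof. by move=> It; apply: (Iv_le It); case: It => t0 _; lra. Qed.

Lemma measurable_Iv : measurable (Iv Rtot).
Proof.
apply: is_interval_measurable => a b [a0 _] [_ bR] c /andP[ac cb].
by split; [exact: lt_le_trans ac|rewrite (le_lt_trans _ bR) ?lee_fin].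
Qed.

Section Quasiconcave.
Variable phi : R -> R.
Hypothesis phi_qc : quasiconcave Rtot phi.

Lemma quasiconcave_gt0 t : Iv Rtot t -> (0 < phi t)%R.
Proof.
move: phi_qc => [phi0 phi_eq0 _ _] [t0 tR].
rewrite lt_neqAle phi0 ?ltW// andbT eq_sym; apply/eqP.
by move=> /(phi_eq0 _ (ltW t0) tR) t_eq0; rewrite t_eq0 ltxx in t0.
Qed.

Lemma quasiconcave_le s t : Iv Rtot t -> (0 < s)%R -> (s <= t)%R ->
  (phi s <= phi t)%R.
Proof. by move: phi_qc => [_ _ phi_inc _] [_ tR] s0 st; apply: phi_inc => //; exact: ltW. Qed.

(** Monotonicity of phi(t)/t, compared at t/2 and t. This absorbs the halved argument produced by
    [dstar_quasi_subadditive]. *)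
Lemma quasiconcave_half t : Iv Rtot t -> (phi t <= 2 * phi (t / 2))%R.
Proof.
move=> It; have [t0 tR] := It; have [_ _ _ phi_dec] := phi_qc.
have t20 : (0 < t / 2)%R by lra.
have : (phi t / t <= phi (t / 2) / (t / 2))%R by apply: phi_dec => //; lra.
rewrite ler_pdivrMr// => /le_trans; apply.
by rewrite le_eqVlt; apply/orP; left; apply/eqP; field; rewrite gt_eqF.
Qed.

Lemma measurable_quasiconcave_inv : measurable_fun (Iv Rtot) (fun s => ((phi s)^-1)%:E).
Proof.
apply: nonincreasing_emeasurable => x y Ix Iy xy.
rewrite lee_fin lef_pV2 ?posrE ?quasiconcave_gt0//.
by apply: quasiconcave_le => //; case: Ix.
Qed.

Context (d : measure_display) (T : measurableType d) (mu : {measure set T -> \bar R}).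
Implicit Types u : T -> R.

(** Since u^* is non-increasing, its average over (0, s] is at least u^*(s), that is, u^* <=
    u^**. *)
Lemma le_dstar_Mnorm u s : Iv Rtot s ->
  (phi s)%:E * dstar mu setT u s <= Mnorm Rtot phi mu u.
Proof.
move=> Is; have [s0 _] := Is.
apply: (@le_trans _ _ ((phi s)%:E * dstar2 mu setT u s)); last first.
  by apply: ereal_sup_ubound; exists s.
apply: lee_wpmul2l; first by rewrite lee_fin ltW// quasiconcave_gt0.
rewrite lee_pdivlMl// muleC.
apply: (@le_trans _ _ (\int[@lebesgue_measure R]_(r in `]0%R, s]) cst (dstar mu setT u s) r)).
  rewrite integral_cst// [X in _ <= _ * X](_ : _ = s%:E)//.
  by rewrite [LHS]lebesgue_measure_itv/= lte_fin s0 oppr0 adde0.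
apply: ge0_le_integral => //.
- by move=> r _; exact: dstar_ge0.
- exact: measurable_dstar.
- by move=> r; rewrite /= in_itv/= => /andP[_ rs]; exact: dstar_nonincreasing.
Qed.

(* The B-condition is what upgrades the weak-type bound on [u^*] to a bound on [u^**]. *)
Lemma Mnorm_le_weak u (a B : R) : (0 <= a)%R ->
  (forall t, Iv Rtot t ->
    (t^-1)%:E * \int[@lebesgue_measure R]_(s in `]0%R, t]) ((phi s)^-1)%:E
      <= (B / phi t)%:E) ->
  (forall s, Iv Rtot s -> dstar mu setT u s <= (a / phi s)%:E) ->
  Mnorm Rtot phi mu u <= (a * B)%:E.
Proof.
move=> a0 phiB ua; apply: ge_ereal_sup => _ [s Is <-].
have [s0 _] := Is; have phis := quasiconcave_gt0 Is.
have sI : `]0%R, s]%classic `<=` Iv Rtot.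
  by move=> r; rewrite /= in_itv/= => /andP[r0 rs]; exact: Iv_le rs.
have mphi : measurable_fun `]0%R, s]%classic (fun r => ((phi r)^-1)%:E).
  by apply: measurable_funS sI measurable_quasiconcave_inv; exact: measurable_Iv.
have int_le : \int[@lebesgue_measure R]_(r in `]0%R, s]) dstar mu setT u r <=
    a%:E * \int[@lebesgue_measure R]_(r in `]0%R, s]) ((phi r)^-1)%:E.
  rewrite -ge0_integralZl//; last first.
    by move=> r /sI Ir; rewrite lee_fin invr_ge0 ltW// quasiconcave_gt0.
  apply: ge0_le_integral => //.
  - by move=> r _; exact: dstar_ge0.
  - exact: measurable_dstar.
  - exact: measurable_funeM.
  - by move=> r /sI Ir; rewrite -EFinM ua.
have -> : (a * B)%:E = (phi s)%:E * (a%:E * (B / phi s)%:E).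
  by rewrite -!EFinM; congr EFin; field; rewrite gt_eqF.
apply: lee_wpmul2l; first by rewrite lee_fin ltW.
apply: (@le_trans _ _ (a%:E * ((s^-1)%:E *
    \int[@lebesgue_measure R]_(r in `]0%R, s]) ((phi r)^-1)%:E))).
  rewrite muleCA; apply: lee_wpmul2l => //.
  by rewrite lee_fin invr_ge0 ltW.
by apply: lee_wpmul2l; rewrite ?lee_fin//; exact: phiB.
Qed.

(** Supplies the zero summand when a member of one Marcinkiewicz space is viewed as a member of the
    sum. *)
Lemma inM0 : inM Rtot phi mu (cst 0%R).
Proof.
split => //; apply: (@le_lt_trans _ _ 0); last by rewrite ltry.
apply: ge_ereal_sup => _ [s [s0 sR] <-].
have d0 r : (0 < r)%R -> dstar mu setT (cst 0%R : T -> R) r = 0.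
  move=> r0; apply/eqP; rewrite eq_le dstar_ge0 andbT.
  apply: dstar_le => //.
  have -> : setT `&` [set x | (0 < `|(cst 0%R : T -> R) x|)%R] = set0.
    by rewrite setTI -subset0 => x /=; rewrite normr0 ltxx.
  by rewrite measure0 lee_fin ltW.
rewrite /dstar2 (eq_integral (cst 0)).
  by rewrite integral_cst// mul0e !mule0.
by move=> r; rewrite inE/= in_itv/= => /andP[r0 _]; exact: d0.
Qed.

Lemma inM_dstar_fin u s : inM Rtot phi mu u -> Iv Rtot s -> dstar mu setT u s < +oo.
Proof.
move=> [_ uM] Is; have := le_lt_trans (le_dstar_Mnorm u Is) uM.
have phis := quasiconcave_gt0 Is.
by rewrite !ltey; apply: contra => /eqP ->; rewrite gt0_muley.
Qed.

End Quasiconcave.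

(** The weak bound on u^* gives a norm at most phi(t) x B, and [Op] multiplies it by at most [A].
    Evaluating at t/2 divides by phi(t/2) >= phi(t)/2, so phi(t) cancels and the constant does not
    depend on [t]. *)
Lemma weak_endpoint phi (d1 d2 : measure_display) (T1 : measurableType d1)
  (T2 : measurableType d2) (mu1 : {measure set T1 -> \bar R})
  (mu2 : {measure set T2 -> \bar R}) (Op : (T1 -> R) -> (T2 -> R))
  (A B x t : R) (u : T1 -> R) :
  quasiconcave Rtot phi -> (0 <= A)%R -> (0 <= B)%R -> (0 <= x)%R -> Iv Rtot t ->
  (forall t, Iv Rtot t ->
    (t^-1)%:E * \int[@lebesgue_measure R]_(s in `]0%R, t]) ((phi s)^-1)%:E
      <= (B / phi t)%:E) ->
  (forall f, inM Rtot phi mu1 f -> inM Rtot phi mu2 (Op f) /\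
     Mnorm Rtot phi mu2 (Op f) <= A%:E * Mnorm Rtot phi mu1 f) ->
  measurable_fun setT u ->
  (forall s, Iv Rtot s -> dstar mu1 setT u s <= (phi t * x / phi s)%:E) ->
  inM Rtot phi mu1 u /\
  dstar mu2 setT (Op u) (t / 2) <= (2 * A * B * x)%:E.
Proof.
move=> qc A0 B0 x0 It phiB OpA mu ux.
have phit := quasiconcave_gt0 qc It.
have phit2 := quasiconcave_gt0 qc (Iv_half It).
have uM : Mnorm Rtot phi mu1 u <= (phi t * x * B)%:E.
  by apply: Mnorm_le_weak => //; rewrite mulr_ge0// ltW.
have uin : inM Rtot phi mu1 u by split => //; rewrite (le_lt_trans uM) ?ltry.
split => //; have [_ OpuM] := OpA _ uin.
have Mle : Mnorm Rtot phi mu2 (Op u) <= (A * (phi t * x * B))%:E.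
  by rewrite (le_trans OpuM)// [leRHS]EFinM lee_wpmul2l.
have := le_trans (le_dstar_Mnorm qc mu2 (Op u) (Iv_half It)) Mle.
rewrite -lee_pdivlMl// -EFinM => /le_trans; apply; rewrite lee_fin.
rewrite ler_pdivrMl// (_ : A * _ = (A * B * x) * phi t)%R; last by ring.
rewrite (_ : (phi (t / 2) * _ = (A * B * x) * (2 * phi (t / 2)))%R); last by ring.
by apply: ler_wpM2l; [rewrite !mulr_ge0|exact: quasiconcave_half].
Qed.

End Marcinkiewicz.

(** * The sum space and the pointwise estimate for the operator *)

Section Interpolation.
Set Implicit Arguments. Unset Strict Implicit.
Context (R : realType) (Rtot : \bar R) (phi psi : R -> R).
Hypotheses (phi_qc : quasiconcave Rtot phi) (psi_qc : quasiconcave Rtot psi).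

Lemma inM_inMsuml (d : measure_display) (T : measurableType d)
  (mu : {measure set T -> \bar R}) (f : T -> R) :
  inM Rtot phi mu f -> inMsum Rtot phi psi mu f.
Proof.
move=> fM; exists f, (cst 0%R); split; [exact: fM|exact: inM0|].
by apply/funext => x /=; rewrite addr0.
Qed.

Lemma inM_inMsumr (d : measure_display) (T : measurableType d)
  (mu : {measure set T -> \bar R}) (f : T -> R) :
  inM Rtot psi mu f -> inMsum Rtot phi psi mu f.
Proof.
move=> fM; exists (cst 0%R), f; split; [exact: inM0|exact: fM|].
by apply/funext => x /=; rewrite add0r.
Qed.

(** Quasi-subadditivity with constant 1 reduces this to the two summands at t/2. Finiteness on (0,
    Rtot) is what lets f^* be treated there as a real-valued function. *)
Lemma inMsum_dstar_fin (d : measure_display) (T : measurableType d)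
  (mu : {measure set T -> \bar R}) (f : T -> R) t :
  inMsum Rtot phi psi mu f -> Iv Rtot t -> dstar mu setT f t \is a fin_num.
Proof.
move=> [g [h [gM hM ->]]] It; rewrite ge0_fin_numE ?dstar_ge0//.
have [[mg _] [mh _]] := (gM, hM).
apply: (@le_lt_trans _ _
  (1%:E * (dstar mu setT g (t / 2) + dstar mu setT h (t / 2)))).
  apply: dstar_quasi_subadditive => //; first exact: measurable_funD.
  by apply: aeW => x; rewrite mul1r ler_normD.
rewrite mul1e lte_add_pinfty//.
  by apply: (inM_dstar_fin phi_qc gM); exact: Iv_half.
by apply: (inM_dstar_fin psi_qc hM); exact: Iv_half.
Qed.

Context (d1 d2 : measure_display) (T1 : measurableType d1) (T2 : measurableType d2).
Context (mu1 : {measure set T1 -> \bar R}) (mu2 : {measure set T2 -> \bar R}).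

(* [Sop] and [Top] act on real-valued functions, hence [fine]. *)
Lemma dstar_le_dstar_dstar (f : T1 -> R) t : mu1 setT = Rtot ->
  inMsum Rtot phi psi mu1 f -> measurable_fun setT f -> Iv Rtot t ->
  dstar mu1 setT f t <=
  dstar (@lebesgue_measure R) (Iv Rtot) (fun s => fine (dstar mu1 setT f s)) t.
Proof.
move=> mu1T fM mf It; apply: le_ereal_inf_tmp => _ [l [l0 fl] <-].
apply: dstar_le => //; first exact: ltW.
rewrite leNgt; apply/negP => tf.
(* Arguing by contradiction, a real [c] is placed strictly above [t] and at most the measure of {|f|
   > l}, which may be infinite. *)
have [c tc cf] : exists2 c : R, (t < c)%R &
    c%:E <= mu1 (setT `&` [set x | (l < `|f x|)%R]).
  case: (mu1 _) tf => [c| |] // tc; first by exists c.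
  by exists (t + 1)%R; rewrite ?ltrDl// leey.
have [t0 _] := It.
(* By [mu_gt_dstar], f^* exceeds [l] on all of (0, c), and [mu1 setT = Rtot] keeps this interval
   inside [Iv Rtot]. Its length [c] would then be at most [t]. *)
have : (@lebesgue_measure R) `]0%R, c[ <= t%:E.
  apply: le_trans fl; apply: le_outer_measure => s /=.
  rewrite in_itv/= => /andP[s0 sc].
  have sf : s%:E < mu1 (setT `&` [set x | (l < `|f x|)%R]).
    by apply: lt_le_trans cf; rewrite lte_fin.
  have Is : Iv Rtot s.
    split => //; apply: (lt_le_trans sf); rewrite -mu1T.
    by apply: le_mu => //; exact: measurable_gt_norm.
  split => //; rewrite ger0_norm ?fine_ge0 ?dstar_ge0//.
  rewrite -lte_fin fineK; last exact: inMsum_dstar_fin.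
  rewrite ltNge; apply/negP => fs; move: sf; rewrite ltNge => /negP; apply.
  by apply: mu_gt_dstar => //; exact: ltW.
apply/negP; rewrite -ltNge [ltRHS]lebesgue_measure_itv/= lte_fin (lt_trans t0 tc).
by rewrite oppr0 adde0 lte_fin.
Qed.

Variable Op : (T1 -> R) -> T2 -> R.
Variables (A1 A2 B1 B2 C : R).
Hypotheses (A1_ge0 : (0 <= A1)%R) (A2_ge0 : (0 <= A2)%R).
Hypotheses (B1_ge0 : (0 <= B1)%R) (B2_ge0 : (0 <= B2)%R) (C_gt0 : (0 < C)%R).
Hypothesis phiB : forall t, Iv Rtot t ->
  (t^-1)%:E * \int[@lebesgue_measure R]_(s in `]0%R, t]) ((phi s)^-1)%:E
    <= (B1 / phi t)%:E.
Hypothesis psiB : forall t, Iv Rtot t ->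
  (t^-1)%:E * \int[@lebesgue_measure R]_(s in `]0%R, t]) ((psi s)^-1)%:E
    <= (B2 / psi t)%:E.
Hypothesis Op_phi : forall f, inM Rtot phi mu1 f -> inM Rtot phi mu2 (Op f) /\
  Mnorm Rtot phi mu2 (Op f) <= A1%:E * Mnorm Rtot phi mu1 f.
Hypothesis Op_psi : forall f, inM Rtot psi mu1 f -> inM Rtot psi mu2 (Op f) /\
  Mnorm Rtot psi mu2 (Op f) <= A2%:E * Mnorm Rtot psi mu1 f.
Hypothesis Op_measurable : forall f, inMsum Rtot phi psi mu1 f ->
  measurable_fun setT (Op f).
Hypothesis Op_add : forall f g, inMsum Rtot phi psi mu1 f ->
  inMsum Rtot phi psi mu1 g ->
  {ae mu2, forall x, `|Op (f \+ g) x| <= C * (`|Op f x| + `|Op g x|)}%R.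

(** Here [x] and [y] play the parts of S_phi and T_psi at [t]. The term [2 * A1 * B1] comes from the
    high part [g], bounded by [x], and [4 * A2 * B2] from the low part [h], bounded by y + 2x <= 2(x
    + y). *)
Lemma dstar_Op_le f (x y t : R) : Iv Rtot t -> (0 <= x)%R -> (0 <= y)%R ->
  measurable_fun setT f -> inMsum Rtot phi psi mu1 f ->
  (forall s, (0 < s)%R -> (s < t)%R ->
     (phi s)%:E * dstar mu1 setT f s <= (phi t * x)%:E) ->
  (forall s, (t < s)%R -> s%:E < Rtot ->
     (psi s)%:E * dstar mu1 setT f s <= (psi t * y)%:E) ->
  dstar mu2 setT (Op f) t <=
    (C * (2 * A1 * B1 + 4 * A2 * B2) * (x + y))%:E.
Proof.
move=> It x0 y0 mf fM fx fy; have [t0 tR] := It.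
have phit := quasiconcave_gt0 phi_qc It; have psit := quasiconcave_gt0 psi_qc It.
have phis s : Iv Rtot s -> (0 < phi s)%R := @quasiconcave_gt0 R Rtot phi phi_qc s.
have psis s : Iv Rtot s -> (0 < psi s)%R := @quasiconcave_gt0 R Rtot psi psi_qc s.
pose l := fine (dstar mu1 setT f t).
have lE : dstar mu1 setT f t = l%:E by rewrite fineK// inMsum_dstar_fin.
have l0 : (0 <= l)%R by rewrite fine_ge0// dstar_ge0.
(* The first hypothesis covers only s < t, so f^*(t) is bounded through s = t/2 at the price of the
   factor 2. *)
have l2x : (l <= 2 * x)%R.
  have It2 := Iv_half It.
  rewrite -lee_fin -lE (@le_trans _ _ (dstar mu1 setT f (t / 2)))//.
    by apply: dstar_nonincreasing; lra.
  have := fx (t / 2)%R; rewrite -lee_pdivlMl ?phis// -EFinM.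
  move=> H; apply: le_trans (H _ _) _; [lra|lra|rewrite lee_fin].
  rewrite ler_pdivrMl ?phis// mulrCA mulrA ler_wpM2r//.
  by rewrite (le_trans (quasiconcave_half phi_qc It))// mulrC.
pose g z := if (l < `|f z|)%R then f z else 0%R.
pose h z := if (l < `|f z|)%R then 0%R else f z.
have fgh : f = (g \+ h)%R.
  by apply/funext => z; rewrite /g /h /=; case: ifP; rewrite ?addr0 ?add0r.
have mlf : measurable_fun setT (fun z => (l < `|f z|)%R).
  by apply: measurable_fun_ltr => //; exact: measurableT_comp.
have mg : measurable_fun setT g by exact: measurable_fun_ifT.
have mh : measurable_fun setT h by exact: measurable_fun_ifT.
have gf s : dstar mu1 setT g s <= dstar mu1 setT f s.
  by apply: dstar_le_abs => // z; rewrite /g; case: ifP => // _; rewrite normr0.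
have hf s : dstar mu1 setT h s <= dstar mu1 setT f s.
  by apply: dstar_le_abs => // z; rewrite /h; case: ifP => // _; rewrite normr0.
have hl s : (0 < s)%R -> dstar mu1 setT h s <= l%:E.
  move=> s0; apply: dstar_le => //.
  rewrite (_ : _ `&` _ = set0) ?measure0 ?lee_fin ?ltW//.
  rewrite setTI -subset0 => z /=; rewrite /h; case: ifPn.
    by move=> _; rewrite normr0 ltNge l0.
  by move/negP.
(* [g] lives on {|f| > l}, and l = f^*(t) makes the measure of that set at most [t]; hence s = t is
   included. *)
have g0 s : (t <= s)%R -> dstar mu1 setT g s <= 0.
  move=> ts; apply: dstar_le => //.
  apply: (@le_trans _ _ (mu1 (setT `&` [set z | (l < `|f z|)%R]))).
    apply: le_mu; [exact: measurable_gt_norm..|].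
    by apply: setIS => z /=; rewrite /g; case: ifP => //; rewrite normr0 ltxx.
  by apply: mu_gt_dstar; rewrite // (le_trans _ (lexx l%:E))// -lE dstar_nonincreasing.
have gphi s : Iv Rtot s -> dstar mu1 setT g s <= (phi t * x / phi s)%:E.
  move=> Is; have [s0 _] := Is.
  have [st|ts] := ltP s t; last first.
    apply: le_trans (g0 _ ts) _; have phis0 := ltW (phis _ Is).
    by rewrite lee_fin divr_ge0 ?mulr_ge0// ltW.
  rewrite (le_trans (gf _))// mulrC EFinM lee_pdivlMl ?phis//.
  exact: fx.
have hpsi s : Iv Rtot s -> dstar mu1 setT h s <= (psi t * (y + 2 * x) / psi s)%:E.
  move=> Is; have [s0 sR] := Is.
  rewrite mulrC EFinM lee_pdivlMl ?psis//.
  (* Up to and including [t], both psi(s) <= psi(t) and h^* <= l <= 2x apply; beyond [t] the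
     hypothesis with [y] takes over. *)
  have [st|ts] := leP s t.
    apply: (@le_trans _ _ ((psi t)%:E * l%:E)).
      have psis0 := ltW (psis _ Is).
      apply: lee_pmul; rewrite ?dstar_ge0 ?lee_fin ?hl//.
      exact: (quasiconcave_le psi_qc It).
    rewrite -EFinM lee_fin; apply: ler_wpM2l; first exact: ltW.
    by rewrite (le_trans l2x)// lerDr.
  apply: le_trans (_ : (psi t * y)%:E <= _).
    have psis0 := ltW (psis _ Is).
    by apply: le_trans (fy _ ts sR); rewrite lee_wpmul2l ?lee_fin.
  rewrite lee_fin; apply: ler_wpM2l; first exact: ltW.
  by rewrite lerDl mulr_ge0.
have yx0 : (0 <= y + 2 * x)%R by lra.
have [gM Opg] := weak_endpoint phi_qc A1_ge0 B1_ge0 x0 It phiB Op_phi mg gphi.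
have [hM Oph] := weak_endpoint psi_qc A2_ge0 B2_ge0 yx0 It psiB Op_psi mh hpsi.
have gMs := inM_inMsuml gM; have hMs := inM_inMsumr hM.
have Opgh := Op_add gMs hMs; rewrite -fgh in Opgh.
apply: le_trans (dstar_quasi_subadditive _ C_gt0 _ _ _ Opgh) _;
  [exact: Op_measurable..|].
apply: (@le_trans _ _ (C%:E * ((2 * A1 * B1 * x)%:E + (2 * A2 * B2 * (y + 2 * x))%:E))).
  by apply: lee_wpmul2l; [rewrite lee_fin ltW|exact: leeD].
rewrite -EFinD -EFinM lee_fin -[leRHS]mulrA; apply: ler_wpM2l; first exact: ltW.
(* The two sides differ by 2 A1 B1 y + 2 A2 B2 y. *)
have := mulr_ge0 (mulr_ge0 A1_ge0 B1_ge0) y0.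
have := mulr_ge0 (mulr_ge0 A2_ge0 B2_ge0) y0.
lra.
Qed.

End Interpolation.

(** * The supremum operators as non-negative measurable functions *)

Section Operators.
Set Implicit Arguments. Unset Strict Implicit.
Context (R : realType) (Rtot : \bar R) (phi : R -> R).
Hypothesis phi_qc : quasiconcave Rtot phi.

Lemma nnm_dstar (d : measure_display) (T : measurableType d)
  (mu : {measure set T -> \bar R}) (f : T -> R) : nnm Rtot (dstar mu setT f).
Proof. by split => [t _|]; [exact: dstar_ge0|exact: measurable_dstar]. Qed.

Lemma nnm_Sop (f : R -> R) : nnm Rtot (Sop Rtot phi f).
Proof.
split => [t It|].
  apply: mule_ge0; first by rewrite lee_fin invr_ge0 ltW// (quasiconcave_gt0 phi_qc).
  have It2 := Iv_half It; have [t20 _] := It2; have [t0 _] := It.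
  (* A supremum over the empty set would be [-oo]; the point t/2 shows that the index set is
     inhabited. *)
  apply: le_ereal_sup_tmp.
  exists ((phi (t / 2))%:E * dstar (@lebesgue_measure R) (Iv Rtot) f (t / 2)).
    by exists (t / 2)%R => //; split => //; lra.
  apply: mule_ge0; last exact: dstar_ge0.
  by rewrite lee_fin ltW// (quasiconcave_gt0 phi_qc).
apply: emeasurable_funM; first exact: measurable_quasiconcave_inv.
apply: nondecreasing_emeasurable => x y _ _ xy.
apply: ereal_sup_le => _ [s [s0 sx] <-]; exists s => //; split => //.
exact: lt_le_trans xy.
Qed.

Lemma nnm_Top (f : R -> R) : nnm Rtot (Top Rtot phi f).
Proof.
split => [t It|].
  apply: mule_ge0; first by rewrite lee_fin invr_ge0 ltW// (quasiconcave_gt0 phi_qc).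
  have [t0 tR] := It.
  (* A point strictly between [t] and [Rtot] keeps the supremum from being [-oo]: the midpoint if
     [Rtot] is finite, [t + 1] otherwise. *)
  have [s ts sR] : exists2 s : R, (t < s)%R & s%:E < Rtot.
    move: tR; case: (Rtot) => [r| |] //.
      by rewrite lte_fin => tr; exists ((t + r) / 2)%R; rewrite ?lte_fin; lra.
    by exists (t + 1)%R; rewrite ?ltry ?ltrDl.
  apply: le_ereal_sup_tmp.
  exists ((phi s)%:E * dstar (@lebesgue_measure R) (Iv Rtot) f s); first by exists s.
  apply: mule_ge0; last exact: dstar_ge0.
  rewrite lee_fin ltW//; apply: (quasiconcave_gt0 phi_qc).
  by split => //; exact: lt_trans ts.
apply: emeasurable_funM; first exact: measurable_quasiconcave_inv.
apply: nonincreasing_emeasurable => x y _ _ xy.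
apply: ereal_sup_le => _ [s [ys sR] <-]; exists s => //; split => //.
exact: le_lt_trans ys.
Qed.

(** Undoes the division by phi(t), to produce the hypothesis on [x] of [dstar_Op_le]. *)
Lemma le_Sop (f : R -> R) s t x : Iv Rtot t -> (0 < s)%R -> (s < t)%R ->
  Sop Rtot phi f t = x%:E ->
  (phi s)%:E * dstar (@lebesgue_measure R) (Iv Rtot) f s <= (phi t * x)%:E.
Proof.
move=> It s0 st fx; rewrite EFinM -lee_pdivrMl ?(quasiconcave_gt0 phi_qc)//.
rewrite -fx; apply: lee_wpmul2l.
  by rewrite lee_fin invr_ge0 ltW// (quasiconcave_gt0 phi_qc).
by apply: ereal_sup_ubound; exists s.
Qed.

Lemma le_Top (f : R -> R) s t y : Iv Rtot t -> (t < s)%R -> s%:E < Rtot ->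
  Top Rtot phi f t = y%:E ->
  (phi s)%:E * dstar (@lebesgue_measure R) (Iv Rtot) f s <= (phi t * y)%:E.
Proof.
move=> It ts sR fy; rewrite EFinM -lee_pdivrMl ?(quasiconcave_gt0 phi_qc)//.
rewrite -fy; apply: lee_wpmul2l.
  by rewrite lee_fin invr_ge0 ltW// (quasiconcave_gt0 phi_qc).
by apply: ereal_sup_ubound; exists s.
Qed.

End Operators.

(** * From the pointwise estimate to the norm estimate *)

Theorem theorem1p1 (R : realType) (Rtot : \bar R)
  (d1 : measure_display) (T1 : measurableType d1) (mu1 : {measure set T1 -> \bar R})
  (d2 : measure_display) (T2 : measurableType d2) (mu2 : {measure set T2 -> \bar R})
  (phi psi : R -> R) (Op : (T1 -> R) -> (T2 -> R))
  (rho1 rho2 : (R -> \bar R) -> \bar R) :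
  0 < Rtot ->
  nonatomic mu1 -> sigma_finite setT mu1 -> mu1 setT = Rtot ->
  nonatomic mu2 -> sigma_finite setT mu2 -> mu2 setT = Rtot ->
  quasiconcave Rtot phi -> quasiconcave Rtot psi ->
  Bcond Rtot phi -> Bcond Rtot psi ->
  quasilinear_on (inMsum Rtot phi psi mu1) mu2 Op ->
  (exists C : R, (0 <= C)%R /\ forall f, inM Rtot phi mu1 f ->
     inM Rtot phi mu2 (Op f) /\
     Mnorm Rtot phi mu2 (Op f) <= C%:E * Mnorm Rtot phi mu1 f) ->
  (exists C : R, (0 <= C)%R /\ forall f, inM Rtot psi mu1 f ->
     inM Rtot psi mu2 (Op f) /\
     Mnorm Rtot psi mu2 (Op f) <= C%:E * Mnorm Rtot psi mu1 f) ->
  ri_bfn Rtot rho1 -> ri_bfn Rtot rho2 ->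
  (forall f, inM Rtot phi mu1 f -> inM Rtot psi mu1 f -> inX rho1 mu1 f) ->
  (forall f, inX rho1 mu1 f -> inMsum Rtot phi psi mu1 f) ->
  (forall f, inM Rtot phi mu2 f -> inM Rtot psi mu2 f -> inX rho2 mu2 f) ->
  (forall f, inX rho2 mu2 f -> inMsum Rtot phi psi mu2 f) ->
  bounded0 Rtot rho1 rho2 (Sop Rtot phi) ->
  bounded0 Rtot rho1 rho2 (Top Rtot psi) ->
  exists C : R, (0 <= C)%R /\ forall f, inX rho1 mu1 f ->
    inX rho2 mu2 (Op f) /\ Xnorm rho2 mu2 (Op f) <= C%:E * Xnorm rho1 mu1 f.
Proof.
move=> Rtot0 _ _ mu1T _ _ _ phi_qc psi_qc [B1 [B1_gt0 phiB]] [B2 [B2_gt0 psiB]].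
move=> [Op_meas _ [C [C0 Op_add]]] [A1 [A1_ge0 Op_phi]] [A2 [A2_ge0 Op_psi]].
move=> rho1_ri [rho2_ge0 [_ rho2Z rho2D] rho2_le _ _].
move=> _ X1_sum _ _ [C1 [C1_ge0 SC1]] [C2 [C2_ge0 TC2]].
have [_ _ rho1_le _ _] := rho1_ri.
pose K0 : R := (C * (2 * A1 * B1 + 4 * A2 * B2))%R.
have K0_ge0 : (0 <= K0)%R by rewrite !(mulr_ge0, addr_ge0)// ltW.
(* The extra 1 makes K positive, so that K * +oo = +oo. *)
pose K : R := (K0 + 1)%R; have K_gt0 : (0 < K)%R by exact: ltr_wpDl.
have K_ge0 := ltW K_gt0.
exists (K * (C1 + C2))%R; split; first by rewrite mulr_ge0 ?addr_ge0.
move=> f [mf fX]; have fM := X1_sum f (conj mf fX).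
(* [f0] represents [f] on (0, Rtot). The inclusion of X_1 in the sum space makes f^* finite there,
   so [fine] loses nothing. *)
pose f0 := fun t : R => fine (dstar mu1 setT f t).
have f0E t : Iv Rtot t -> `|f0 t|%:E = dstar mu1 setT f t.
  move=> It; rewrite ger0_norm ?fine_ge0 ?dstar_ge0// fineK//.
  exact: (inMsum_dstar_fin phi_qc psi_qc).
have mf0 : measurable_fun (Iv Rtot) f0.
  by apply: measurableT_comp; [exact: fine_measurable|exact: measurable_dstar].
have nf := nnm_dstar Rtot mu1 f.
have nf0 : nnm Rtot (fun t => `|f0 t|%:E).
  split => [t _|]; first by rewrite lee_fin.
  by apply/measurable_EFinP; apply: measurableT_comp mf0.
have f0f : Xnorm0 rho1 f0 <= Xnorm rho1 mu1 f.
  by apply: rho1_le => //; apply: aeW => t /f0E ->.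
have f0X : inX0 Rtot rho1 f0 by split => //; exact: le_lt_trans fX.
have nS := nnm_Sop phi_qc f0; have nT := nnm_Top psi_qc f0.
have nST : nnm Rtot (Sop Rtot phi f0 \+ Top Rtot psi f0).
  split => [t It|]; first by rewrite adde_ge0 ?(nS.1 t It, nT.1 t It).
  exact: emeasurable_funD nS.2 nT.2.
have nKST : nnm Rtot (fun t => K%:E * (Sop Rtot phi f0 \+ Top Rtot psi f0) t).
  split => [t It|]; first by rewrite mule_ge0 ?(nST.1 t It).
  exact: measurable_funeM nST.2.
have mOpf : measurable_fun setT (Op f) by exact: Op_meas.
have Op_le t : Iv Rtot t -> dstar mu2 setT (Op f) t <=
    K%:E * (Sop Rtot phi f0 \+ Top Rtot psi f0) t.
  move=> It; have S0 := nS.1 t It; have T0 := nT.1 t It.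
  (* If either operator is infinite at [t], the right-hand side is [+oo]; otherwise the real values
     [x] and [y] feed [dstar_Op_le]. *)
  rewrite /=; case ES : (Sop Rtot phi f0 t) S0 => [x| |] // S0; last first.
    by rewrite addye ?gt0_muley ?leey// gt_eqF// (lt_le_trans _ T0).
  case ET : (Top Rtot psi f0 t) T0 => [y| |] // T0; last first.
    by rewrite addey ?gt0_muley ?leey.
  rewrite !lee_fin in S0 T0; have [t0 tR] := It.
  apply: (@le_trans _ _ (K0 * (x + y))%:E); last first.
    by rewrite -EFinD -EFinM lee_fin ler_wpM2r ?addr_ge0// lerDl.
  (* The operators see the rearrangement of [f0], which dominates f^*, so their bounds carry over to
     f^*. *)
  have f0_ge s : Iv Rtot s ->
      dstar mu1 setT f s <= dstar (@lebesgue_measure R) (Iv Rtot) f0 s.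
    exact: (dstar_le_dstar_dstar phi_qc psi_qc).
  apply: (dstar_Op_le phi_qc psi_qc A1_ge0 A2_ge0 (ltW B1_gt0) (ltW B2_gt0) C0
    phiB psiB Op_phi Op_psi Op_meas Op_add) => // s.
    move=> s0 st; have Is := Iv_le It s0 (ltW st).
    apply: le_trans (le_Sop phi_qc It s0 st ES); apply: lee_wpmul2l; last exact: f0_ge.
    by rewrite lee_fin ltW// (quasiconcave_gt0 phi_qc).
  move=> ts sR; have Is : Iv Rtot s by split => //; exact: lt_trans ts.
  apply: le_trans (le_Top psi_qc It ts sR ET); apply: lee_wpmul2l; last exact: f0_ge.
  by rewrite lee_fin ltW// (quasiconcave_gt0 psi_qc).
have Opf_le : Xnorm rho2 mu2 (Op f) <= (K * (C1 + C2))%:E * Xnorm rho1 mu1 f.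
  (* The lattice property of [rho2] turns the pointwise bound into a norm bound; homogeneity and the
     triangle inequality then separate the two operators. *)
  apply: (@le_trans _ _ (rho2 (fun t => K%:E * (Sop Rtot phi f0 \+ Top Rtot psi f0) t))).
    by apply: rho2_le => //; [exact: nnm_dstar|exact: aeW].
  rewrite rho2Z// EFinM -muleA; apply: lee_wpmul2l => //.
  apply: le_trans (rho2D _ _ nS nT) _.
  apply: (@le_trans _ _ (C1%:E * Xnorm0 rho1 f0 + C2%:E * Xnorm0 rho1 f0)).
    by apply: leeD; [exact: SC1|exact: TC2].
  by rewrite EFinD ge0_muleDl//; apply: leeD; apply: lee_wpmul2l.
split => //; split => //; apply: le_lt_trans Opf_le _.
by rewrite lte_mul_pinfty// lee_fin mulr_ge0 ?addr_ge0.
Qed.
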